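(* The set of eigenvalues of $\operatorname{Im} V$ is $\left\{\frac{1}{(2n+1)\pi}: n\in\mathbb{Z}\right\}$.
   Context: $L^2[0,1]$ is the complex Hilbert space of square-integrable functions on $[0,1]$. The Volterra operator $V:L^2[0,1]\to L^2[0,1]$ is defined by $Vf(x):=\int_0^x f(t)\,dt$, and its adjoint is $V^*f(x)=\int_x^1 f(t)\,dt$. The imaginary part of $V$ is $\operatorname{Im} V:=(V-V^{*})/(2i)$. *)

(* Defs.v *)
From HB Require Import structures.
From mathcomp Require Import all_boot all_order all_algebra.
From mathcomp Require Import all_classical all_reals all_analysis.
From mathcomp Require Import generic_quotient ring_quotient complex.
From mathcomp Require Import ring lra.
From mathcomp Require Import measurable_realfun.

Set Implicit Arguments.
Unset Strict Implicit.
Unset Printing Implicit Defensive.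

Import Order.TTheory GRing.Theory Num.Theory.
Import numFieldNormedType.Exports.

Local Open Scope ring_scope.
Local Open Scope complex_scope.
Local Open Scope classical_set_scope.
Local Open Scope quotient_scope.

Section real_L2.
Context {R : realType}.
Notation mu := (@lebesgue_measure R).
Notation T := (measurableTypeR R).
Notation I := (`[0%R, 1%R] : set T).
Implicit Types g h : R -> R.

Definition real_sqint g :=
  measurable_fun I g /\ mu.-integrable I (fun x => (g x ^+ 2)%:E).

Lemma measurable_I : measurable I.
Proof. exact: measurable_itv. Qed.

Lemma mu_I_fin : (mu I < +oo)%E.
Proof. by rewrite lebesgue_measure_itv/= lte_fin ltr01 oppr0 adde0 ltry. Qed.

Lemma integrable_cst_I (c : R) : mu.-integrable I (fun=> c%:E).
Proof.
apply: (@continuous_compact_integrable R (cst c)); first exact: segment_compact.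
by apply: continuous_subspaceT => x; exact: cvg_cst.
Qed.

Lemma le_integrable_I g h : measurable_fun I g ->
  (forall x, I x -> `|g x| <= h x) -> mu.-integrable I (EFin \o h) ->
  mu.-integrable I (EFin \o g).
Proof.
move=> mg gh; apply: (le_integrable measurable_I) => //.
  exact/measurable_EFinP.
by move=> x Ix /=; rewrite lee_fin; exact: le_trans (gh _ Ix) (ler_norm _).
Qed.

Lemma real_sqint_mul g h : real_sqint g -> real_sqint h ->
  mu.-integrable I (fun x => (g x * h x)%:E).
Proof.
move=> [mg ig] [mh ih].
apply: (@le_integrable_I (fun x => g x * h x) (fun x => g x ^+ 2 + h x ^+ 2)).
- exact: measurable_funM.
- move=> x _; rewrite ler_norml; apply/andP; split.
    have := sqr_ge0 (g x + h x); have := sqr_ge0 (g x); have := sqr_ge0 (h x).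
    by rewrite sqrrD mulr2n; lra.
  have := sqr_ge0 (g x - h x); have := sqr_ge0 (g x); have := sqr_ge0 (h x).
  by rewrite sqrrB mulr2n; lra.
- exact: (integrableD measurable_I ig ih).
Qed.

Lemma real_sqint_cst (c : R) : real_sqint (cst c).
Proof. by split; [exact: measurable_cst | exact: (integrable_cst_I (c ^+ 2))]. Qed.

Lemma real_sqint_integrable g : real_sqint g -> mu.-integrable I (EFin \o g).
Proof.
move=> sg; have := real_sqint_mul sg (real_sqint_cst 1).
apply: eq_integrable; first exact: measurable_I.
by move=> x _ /=; rewrite mulr1.
Qed.

Lemma real_sqintD g h : real_sqint g -> real_sqint h ->
  real_sqint (fun x => g x + h x).
Proof.
move=> sg sh; have [mg ig] := sg; have [mh ih] := sh.
split; first exact: measurable_funD.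
have igh := real_sqint_mul sg sh.
have := integrableD measurable_I (integrableD measurable_I ig ih)
  (integrableD measurable_I igh igh).
apply: eq_integrable; first exact: measurable_I.
by move=> x _ /=; rewrite -!EFinD sqrrD mulr2n; congr EFin; ring.
Qed.

Lemma real_sqintZ (c : R) g : real_sqint g -> real_sqint (fun x => c * g x).
Proof.
move=> [mg ig]; split; first exact: measurable_funM.
have := integrableZl measurable_I (c ^+ 2) ig.
apply: eq_integrable; first exact: measurable_I.
by move=> x _ /=; rewrite -EFinM exprMn.
Qed.

Lemma real_sqintN g : real_sqint g -> real_sqint (fun x => - g x).
Proof.
move=> /(real_sqintZ (-1)).
by rewrite (_ : (fun x => -1 * g x) = (fun x => - g x))//; apply/funext => x; rewrite mulN1r.
Qed.

Lemma continuous_real_sqint g : {within I, continuous g} -> real_sqint g.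
Proof.
move=> cg; split; first exact: (subspace_continuous_measurable_fun measurable_I cg).
apply: (@continuous_compact_integrable R (fun x => g x ^+ 2));
  first exact: segment_compact.
by move=> x; apply: continuousM; exact: cg.
Qed.


Lemma eq_real_sqint g h : (forall x, I x -> g x = h x) ->
  real_sqint g -> real_sqint h.
Proof.
move=> gh [mg ig]; split.
  by apply: eq_measurable_fun mg => x; rewrite inE; exact: gh.
by apply: eq_integrable ig => // x; rewrite inE => /gh ->.
Qed.

Definition real_volterra g (x : R) : R := \int[mu]_(t in `[0, x]) g t.
Definition real_volterra_adj g (x : R) : R := \int[mu]_(t in `[x, 1]) g t.

Lemma real_sqint_volterra g :
  mu.-integrable I (EFin \o g) -> real_sqint (real_volterra g).
Proof.
by move=> ig; apply: continuous_real_sqint; exact: parameterized_integral_continuous.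
Qed.

Lemma real_volterra_adjE g x : mu.-integrable I (EFin \o g) -> I x ->
  real_volterra_adj g x = real_volterra g 1 - real_volterra g x.
Proof.
move=> ig Ix.
move: Ix; rewrite /= in_itv/= => /andP[x0 x1].
rewrite /real_volterra_adj /real_volterra.
rewrite Rintegral_itvB ?bnd_simp// Rintegral_itv_obnd_cbnd//.
apply: (integrableS measurable_I _ _ ig) => //.
by move=> y /=; rewrite !in_itv/= => /andP[xy ->]; rewrite (le_trans x0)// ltW.
Qed.

Lemma real_sqint_volterra_adj g :
  mu.-integrable I (EFin \o g) -> real_sqint (real_volterra_adj g).
Proof.
move=> ig.
have := real_sqintD (real_sqint_cst (real_volterra g 1))
  (real_sqintN (real_sqint_volterra ig)).
by apply: eq_real_sqint => x Ix; rewrite real_volterra_adjE.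
Qed.

Lemma real_volterra_adjoint g h :
  mu.-integrable I (EFin \o g) -> mu.-integrable I (EFin \o h) ->
  \int[mu]_(x in I) (real_volterra g x * h x) =
  \int[mu]_(x in I) (g x * real_volterra_adj h x).
Proof.
move=> ig ih.
pose F (z : T * T) : \bar R :=
  ((\1_[set u : T * T | u.2 <= u.1] z) * ((g \_ I) z.2 * (h \_ I) z.1))%:E.
have mpatch f : mu.-integrable I (EFin \o f) -> measurable_fun (setT : set T) (f \_ I).
  move=> /integrableP[/measurable_EFinP mf _].
  by apply/(measurable_restrictT _ measurable_I).
have mgI := mpatch _ ig; have mhI := mpatch _ ih.
have mF : measurable_fun setT F.
  apply/measurable_EFinP; apply: measurable_funM; last first.
    by apply: measurable_funM; apply: measurableT_comp => //.
  apply: measurable_indic.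
  rewrite -[X in measurable X]setTI.
  exact: (measurable_fun_le measurableT (@measurable_snd _ _ T T) measurable_fst).
have ipatch f : mu.-integrable I (EFin \o f) ->
    mu.-integrable setT (fun x => (`|(f \_ I) x|)%:E).
  move=> /(integrable_mkcond (EFin \o f) measurable_I) /integrable_abse.
  by apply: eq_integrable => // x _ /=; rewrite !patchE; case: ifPn => //= _; rewrite ?normr0.
have iF : (mu \x mu)%E.-integrable setT F.
  apply/integrable12ltyP => //.
  set G := (\int[mu]_y (`|(g \_ I) y|%:E))%E.
  have Gfin : (G < +oo)%E by exact: (integrable_lty measurableT (ipatch _ ig)).
  have G0 : (0 <= G)%E by apply: integral_ge0 => y _; rewrite lee_fin.
  have Hfin : (\int[mu]_x (`|(h \_ I) x|%:E) < +oo)%E.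
    by exact: (integrable_lty measurableT (ipatch _ ih)).
  apply: (@le_lt_trans _ _ (\int[mu]_x (`|(h \_ I) x|%:E * G))%E); last first.
    rewrite ge0_integralZr//; last first.
      by apply/measurable_EFinP; exact: measurableT_comp.
    by apply: lte_mul_pinfty => //; rewrite ?ge0_fin_numE//; exact: integral_ge0.
  apply: ge0_le_integral => //.
  - by move=> x _; exact: integral_ge0.
  - apply: (measurable_fun_fubini_tonelli_F (abse \o F)).
      exact: measurableT_comp.
    by move=> z; exact: abse_ge0.
  - by apply: emeasurable_funM => //; apply/measurable_EFinP; exact: measurableT_comp.
  move=> x _; rewrite -ge0_integralZl//; last first.
    by apply/measurable_EFinP; exact: measurableT_comp.
  apply: ge0_le_integral => //.
  - by apply: measurableT_comp => //; exact: (measurableT_comp mF).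
  - by apply/measurable_EFinP; apply: measurable_funM => //; exact: measurableT_comp.
  move=> y _; rewrite /F/= lee_fin !normrM [leRHS]mulrC ler_piMl ?mulr_ge0// indicE.
  by case: (_ \in _) => /=; rewrite ?normr1 ?normr0.
have inA (x y : R) : ((x, y) \in [set u : T * T | u.2 <= u.1]) = (y <= x).
  by apply/idP/idP; rewrite inE.
have F1 x : (\int[mu]_y F (x, y))%E =
    (((fun x => real_volterra g x * h x) \_ I) x)%:E.
  rewrite patchE; case: ifPn => [xI|xI].
    have := xI; rewrite inE/= in_itv/= => /andP[x0 x1].
    have ig' : mu.-integrable `[0, x] (EFin \o g).
      apply: (integrableS measurable_I _ _ ig) => //.
      by move=> y /=; rewrite !in_itv/= => /andP[-> /le_trans->].
    rewrite mulrC -RintegralZl// /Rintegral fineK; last first.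
      exact: (integrable_fin_num _ (integrableZl _ (h x) ig')).
    rewrite [RHS]integral_mkcond; apply: eq_integral => y _.
    rewrite /F/= indicE inA !patchE xI.
    have -> : (y \in `[0, x]%classic) = (y <= x) && (y \in I).
      apply/idP/andP; rewrite !inE/= !in_itv/=.
        by move=> /andP[-> yx]; rewrite yx (le_trans yx).
      by move=> [-> /andP[->]].
    by case: (y <= x) => /=; case: (y \in I); rewrite ?mul0r ?mul1r// mulrC.
  rewrite integral0_eq// => y _.
  by rewrite /F/= [(h \_ I) x]patchE (negPf xI) !mulr0.
have F2 y : (\int[mu]_x F (x, y))%E =
    (((fun y => g y * real_volterra_adj h y) \_ I) y)%:E.
  rewrite patchE; case: ifPn => [yI|yI].
    have := yI; rewrite inE/= in_itv/= => /andP[y0 y1].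
    have ih' : mu.-integrable `[y, 1] (EFin \o h).
      apply: (integrableS measurable_I _ _ ih) => //.
      by move=> x /=; rewrite !in_itv/= => /andP[/(le_trans y0)-> ->].
    rewrite -RintegralZl// /Rintegral fineK; last first.
      exact: (integrable_fin_num _ (integrableZl _ (g y) ih')).
    rewrite [RHS]integral_mkcond; apply: eq_integral => x _.
    rewrite /F/= indicE inA !patchE yI.
    have -> : (x \in `[y, 1]%classic) = (y <= x) && (x \in I).
      apply/idP/andP; rewrite !inE/= !in_itv/=.
        by move=> /andP[yx ->]; rewrite yx (le_trans y0).
      by move=> [-> /andP[_ ->]].
    by case: (y <= x) => /=; case: (x \in I); rewrite ?mul0r ?mul1r ?mulr0.
  rewrite integral0_eq// => x _.
  by rewrite /F/= [(g \_ I) y]patchE (negPf yI) mul0r mulr0.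
have := Fubini iF.
under eq_integral do rewrite F1.
under [in RHS]eq_integral do rewrite F2.
move=> FE; rewrite Rintegral_mkcond [in RHS]Rintegral_mkcond.
exact: (congr1 fine FE).
Qed.

Lemma real_volterraD g h x : mu.-integrable I (EFin \o g) ->
  mu.-integrable I (EFin \o h) -> I x ->
  real_volterra (fun t => g t + h t) x = real_volterra g x + real_volterra h x.
Proof.
rewrite /= in_itv/= => ig ih /andP[x0 x1]; rewrite /real_volterra RintegralD//.
  apply: (integrableS measurable_I _ _ ig) => //.
  by move=> y /=; rewrite !in_itv/= => /andP[-> /le_trans->].
apply: (integrableS measurable_I _ _ ih) => //.
by move=> y /=; rewrite !in_itv/= => /andP[-> /le_trans->].
Qed.

Lemma real_volterraZ (c : R) g x : mu.-integrable I (EFin \o g) -> I x ->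
  real_volterra (fun t => c * g t) x = c * real_volterra g x.
Proof.
rewrite /= in_itv/= => ig /andP[x0 x1]; rewrite /real_volterra RintegralZl//.
apply: (integrableS measurable_I _ _ ig) => //.
by move=> y /=; rewrite !in_itv/= => /andP[-> /le_trans->].
Qed.

Lemma real_volterra_ae_eq g h x : mu.-integrable I (EFin \o g) ->
  mu.-integrable I (EFin \o h) ->
  ae_eq mu I g h -> I x -> real_volterra g x = real_volterra h x.
Proof.
rewrite /= in_itv/= => ig ih gh /andP[x0 x1].
have sub : `[0, x] `<=` (I : set R).
  by move=> y /=; rewrite !in_itv/= => /andP[-> /le_trans->].
rewrite /real_volterra /Rintegral; congr fine; apply: ae_eq_integral => //.
- by apply: measurable_funS sub _ => //; have /integrableP[] := ig.
- by apply: measurable_funS sub _ => //; have /integrableP[] := ih.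
by apply: filterS gh => y ghy /sub Iy; congr EFin; exact: ghy.
Qed.
End real_L2.

Section complex_L2.
Variable R : realType.
Notation mu := (@lebesgue_measure R).
Notation T := (measurableTypeR R).
Notation I := (`[0%R, 1%R] : set T).
Notation Re := (@complex.Re R).
Notation Im := (@complex.Im R).
Notation normc := (@Normc.normc R).
Implicit Types (f : R -> R[i]) (c : R[i]).

(* Elements of L^2[0,1] are represented by functions on the whole line; their
   values outside [0,1] are irrelevant. *)
Definition square_integrable f : Prop :=
  [/\ measurable_fun I (Re \o f), measurable_fun I (Im \o f) &
      (\int[mu]_(x in I) (normc (f x) ^+ 2)%:E < +oo)%E].

Definition complex_integral (D : set R) f : R[i] :=
  (\int[mu]_(x in D) Re (f x)) +i* (\int[mu]_(x in D) Im (f x)).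

Lemma sqr_normcE c : normc c ^+ 2 = Re c ^+ 2 + Im c ^+ 2.
Proof. by case: c => a b /=; rewrite sqr_sqrtr// addr_ge0// sqr_ge0. Qed.

Lemma square_integrableP f :
  square_integrable f <-> real_sqint (Re \o f) /\ real_sqint (Im \o f).
Proof.
split=> [[mr mi nf]|[[mr ir] [mi ii]]]; last first.
  split => //; have := integrable_lty measurable_I
    (integrableD measurable_I ir ii).
  by congr (_ < _)%E; apply: eq_integral => x _; rewrite sqr_normcE.
have i2 : mu.-integrable I (EFin \o (fun x => normc (f x) ^+ 2)).
  apply/integrableP; split.
    apply/measurable_EFinP.
    rewrite (_ : (fun x => _) = (fun x => Re (f x) ^+ 2 + Im (f x) ^+ 2)).
      by apply: measurable_funD; exact: measurable_funX.
    by apply/funext => x; rewrite sqr_normcE.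
  move: nf; congr (_ < _)%E; apply: eq_integral => x _ /=.
  by rewrite ger0_norm// sqr_ge0.
split; split => //; apply: (@le_integrable_I _ _ _ _ _ i2).
- exact: measurable_funX.
- by move=> x _; rewrite ger0_norm ?sqr_ge0// sqr_normcE lerDl sqr_ge0.
- exact: measurable_funX.
- by move=> x _; rewrite ger0_norm ?sqr_ge0// sqr_normcE lerDr sqr_ge0.
Qed.

Definition sqint_pred : {pred R -> R[i]} := mem [set f | square_integrable f].

Lemma sqint_submod_closed : submod_closed sqint_pred.
Proof.
split=> [|c f g]; rewrite !inE/=.
  by apply/square_integrableP; split; exact: real_sqint_cst.
move=> /square_integrableP[rf jf] /square_integrableP[rg jg].
apply/square_integrableP; split.
  apply: (eq_real_sqint _ (real_sqintD (real_sqintD (real_sqintZ (Re c) rf)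
    (real_sqintZ (- Im c) jf)) rg)) => x _ /=.
  rewrite -[(c *: f + g) x]/(c * f x + g x).
  by case: c (f x) (g x) => a b [u v] [p q] /=; rewrite mulNr.
apply: (eq_real_sqint _ (real_sqintD (real_sqintD (real_sqintZ (Re c) jf)
    (real_sqintZ (Im c) rf)) jg)) => x _ /=.
rewrite -[(c *: f + g) x]/(c * f x + g x).
by case: c (f x) (g x) => a b [u v] [p q] /=.
Qed.

HB.instance Definition _ :=
  GRing.isSubmodClosed.Build R[i] (R -> R[i]) sqint_pred sqint_submod_closed.

Record L2fun := MkL2fun {
  L2fun_val :> R -> R[i];
  L2fun_valP : L2fun_val \in sqint_pred }.

HB.instance Definition _ := [isSub for L2fun_val].
HB.instance Definition _ := [Choice of L2fun by <:].
HB.instance Definition _ := [SubChoice_isSubLmodule of L2fun by <:].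

Definition L2fun_null : {pred L2fun} :=
  mem [set f : L2fun | ae_eq mu I f (cst 0)].

Lemma L2fun_null_zmod_closed : zmod_closed L2fun_null.
Proof.
split=> [|f g]; rewrite !inE/=.
  by apply: aeW => x _.
apply: filterS2 => x f0 g0 Ix.
by rewrite [LHS](_ : _ = f x - g x)// f0// g0// subr0.
Qed.

HB.instance Definition _ :=
  GRing.isZmodClosed.Build L2fun L2fun_null L2fun_null_zmod_closed.

(* Square-integrable functions modulo equality almost everywhere on [0,1]. *)
Definition L2 := Quotient.quot L2fun_null.
HB.instance Definition _ := GRing.Zmodule.on L2.
HB.instance Definition _ := EqQuotient.on L2.

Lemma L2_eqP (f g : L2fun) : \pi_L2 f = \pi_L2 g <-> ae_eq mu I f g.
Proof.
have -> : (\pi_L2 f = \pi_L2 g) <-> (f - g \in L2fun_null).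
  by rewrite (Quotient.idealrBE L2fun_null); split=> [/eqP//|/eqP].
rewrite inE/=; split; apply: filterS => x fg Ix.
  by apply/eqP; rewrite -subr_eq0; apply/eqP; exact: fg.
by rewrite [LHS](_ : _ = f x - g x)// fg// subrr.
Qed.

Lemma repr_L2 (f : L2fun) : ae_eq mu I (repr (\pi_L2 f)) f.
Proof. by apply/L2_eqP; rewrite reprK. Qed.

Definition L2_scale c (u : L2) : L2 := \pi_L2 (c *: repr u).

Lemma pi_L2D (f g : L2fun) : \pi_L2 (f + g) = \pi_L2 f + \pi_L2 g.
Proof. by rewrite piE. Qed.

Lemma pi_L2_scale c (f : L2fun) : L2_scale c (\pi_L2 f) = \pi_L2 (c *: f).
Proof.
apply/L2_eqP; apply: filterS (repr_L2 f) => x fx Ix.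
by rewrite -[LHS]/(c * repr (\pi_L2 f) x) fx.
Qed.

Fact L2_scaleA a b (u : L2) : L2_scale a (L2_scale b u) = L2_scale (a * b) u.
Proof. by rewrite -[u]reprK !pi_L2_scale scalerA reprK. Qed.

Fact L2_scale1 : left_id 1 L2_scale.
Proof. by move=> u; rewrite -[u]reprK pi_L2_scale scale1r. Qed.

Fact L2_scaleDr : right_distributive L2_scale +%R.
Proof.
move=> c u v; rewrite -[u]reprK -[v]reprK -pi_L2D !pi_L2_scale -pi_L2D.
by rewrite scalerDr.
Qed.

Fact L2_scaleDl (u : L2) : {morph L2_scale^~ u : a b / a + b}.
Proof. by move=> a b; rewrite -[u]reprK !pi_L2_scale -pi_L2D scalerDl. Qed.

HB.instance Definition _ := GRing.Zmodule_isLmodule.Build R[i] L2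
  L2_scaleA L2_scale1 L2_scaleDr L2_scaleDl.

Lemma pi_L2Z c (f : L2fun) : \pi_L2 (c *: f) = c *: \pi_L2 f.
Proof. by rewrite -pi_L2_scale. Qed.

Definition volterra_fun f (x : R) : R[i] := complex_integral `[0, x] f.
Definition volterra_adj_fun f (x : R) : R[i] := complex_integral `[x, 1] f.

Lemma L2fun_sqint (f : L2fun) : real_sqint (Re \o f) /\ real_sqint (Im \o f).
Proof. by have := L2fun_valP f; rewrite inE/= => /square_integrableP. Qed.

Lemma integrable_Re (f : L2fun) : mu.-integrable I (EFin \o (Re \o f)).
Proof.
by apply: real_sqint_integrable; have [] := L2fun_sqint f.
Qed.

Lemma integrable_Im (f : L2fun) : mu.-integrable I (EFin \o (Im \o f)).
Proof.
by apply: real_sqint_integrable; have [] := L2fun_sqint f.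
Qed.

Lemma sqint_volterra (f : L2fun) : volterra_fun f \in sqint_pred.
Proof.
rewrite inE/=; apply/square_integrableP; split.
  exact: (real_sqint_volterra (integrable_Re f)).
exact: (real_sqint_volterra (integrable_Im f)).
Qed.

Lemma sqint_volterra_adj (f : L2fun) : volterra_adj_fun f \in sqint_pred.
Proof.
rewrite inE/=; apply/square_integrableP; split.
  exact: (real_sqint_volterra_adj (integrable_Re f)).
exact: (real_sqint_volterra_adj (integrable_Im f)).
Qed.

Definition volterra (u : L2) : L2 := \pi_L2 (MkL2fun (sqint_volterra (repr u))).

Definition volterra_adj (u : L2) : L2 :=
  \pi_L2 (MkL2fun (sqint_volterra_adj (repr u))).

Lemma ae_eq_Re f g : ae_eq mu I f g -> ae_eq mu I (Re \o f) (Re \o g).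
Proof. by apply: filterS => x fg Ix; rewrite /= fg. Qed.

Lemma ae_eq_Im f g : ae_eq mu I f g -> ae_eq mu I (Im \o f) (Im \o g).
Proof. by apply: filterS => x fg Ix; rewrite /= fg. Qed.

Lemma volterra_pi (f : L2fun) :
  volterra (\pi_L2 f) = \pi_L2 (MkL2fun (sqint_volterra f)).
Proof.
apply/L2_eqP; apply: aeW => x Ix /=; congr Complex.
  apply: (real_volterra_ae_eq _ _ _ Ix); [exact: integrable_Re..|].
  exact/ae_eq_Re/repr_L2.
apply: (real_volterra_ae_eq _ _ _ Ix); [exact: integrable_Im..|].
exact/ae_eq_Im/repr_L2.
Qed.

Lemma volterra_adj_funE (f : L2fun) x : I x ->
  volterra_adj_fun f x = volterra_fun f 1 - volterra_fun f x.
Proof.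
move=> Ix; congr Complex.
  exact: (real_volterra_adjE (integrable_Re f)).
exact: (real_volterra_adjE (integrable_Im f)).
Qed.

Lemma volterra_adj_pi (f : L2fun) :
  volterra_adj (\pi_L2 f) = \pi_L2 (MkL2fun (sqint_volterra_adj f)).
Proof.
have I1 : I 1 by rewrite /= in_itv/= ler01 lexx.
apply/L2_eqP; apply: aeW => x Ix /=; rewrite !volterra_adj_funE//.
congr (_ - _); congr Complex; apply: real_volterra_ae_eq => //;
  solve [exact: integrable_Re | exact: integrable_Im
        | exact/ae_eq_Re/repr_L2 | exact/ae_eq_Im/repr_L2].
Qed.

Lemma volterra_funP c (f g : L2fun) x : I x ->
  volterra_fun (c *: f + g) x = c * volterra_fun f x + volterra_fun g x.
Proof.
move=> Ix; have [rf jf] := L2fun_sqint f; have [rg jg] := L2fun_sqint g.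
have VE (a b : R) (p q r : R -> R) : real_sqint p -> real_sqint q ->
    real_sqint r -> real_volterra (fun t => a * p t + b * q t + r t) x =
    a * real_volterra p x + b * real_volterra q x + real_volterra r x.
  move=> sp sq sr.
  have sap := real_sqintZ a sp; have sbq := real_sqintZ b sq.
  rewrite real_volterraD//; [|exact: real_sqint_integrable (real_sqintD sap sbq)
                            |exact: real_sqint_integrable].
  rewrite real_volterraD//; [|exact: real_sqint_integrable..].
  by rewrite !real_volterraZ//; exact: real_sqint_integrable.
transitivity (real_volterra (fun t => Re c * Re (f t) + (- Im c) * Im (f t) +
    Re (g t)) x +i* real_volterra (fun t => Re c * Im (f t) + Im c * Re (f t) +
    Im (g t)) x).
  congr Complex; apply: eq_Rintegral => t _; rewrite /= -[LHS]/(_ (c * f t + g t));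
    by case: c (f t) (g t) => a b [u v] [p q] /=; rewrite ?mulNr.
rewrite !VE//; case: c => a b; apply/eqP; rewrite eq_complex/=.
by rewrite mulNr !eqxx.
Qed.

Lemma volterra_linear : linear volterra.
Proof.
move=> c u v; rewrite -[u]reprK -[v]reprK -pi_L2Z -pi_L2D !volterra_pi.
rewrite -pi_L2Z -pi_L2D; apply/L2_eqP; apply: aeW => x Ix.
exact: volterra_funP.
Qed.

Lemma volterra_adj_linear : linear volterra_adj.
Proof.
have I1 : I 1 by rewrite /= in_itv/= ler01 lexx.
move=> c u v; rewrite -[u]reprK -[v]reprK -pi_L2Z -pi_L2D !volterra_adj_pi.
rewrite -pi_L2Z -pi_L2D; apply/L2_eqP; apply: aeW => x Ix.
rewrite -[RHS]/(c * volterra_adj_fun _ x + volterra_adj_fun _ x).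
rewrite -[LHS]/(volterra_adj_fun _ x) !volterra_adj_funE// !volterra_funP//.
ring.
Qed.

HB.instance Definition _ :=
  GRing.isLinear.Build R[i] L2 L2 *:%R volterra volterra_linear.
HB.instance Definition _ :=
  GRing.isLinear.Build R[i] L2 L2 *:%R volterra_adj volterra_adj_linear.

Definition L2_inner (u v : L2) : R[i] :=
  complex_integral I (fun x => repr u x * (repr v x)^*).

Lemma L2_inner_pi (f g : L2fun) :
  L2_inner (\pi_L2 f) (\pi_L2 g) = complex_integral I (fun x => f x * (g x)^*).
Proof.
have iRe (f' g' : L2fun) :
    mu.-integrable I (fun x => (Re (f' x * (g' x)^*))%:E).
  have [rf jf] := L2fun_sqint f'; have [rg jg] := L2fun_sqint g'.
  apply: eq_integrable (integrableD measurable_I (real_sqint_mul rf rg)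
    (real_sqint_mul jf jg)) => // x _ /=.
  by case: (f' x) (g' x) => a b [p q] /=; rewrite mulrN opprK.
have iIm (f' g' : L2fun) :
    mu.-integrable I (fun x => (Im (f' x * (g' x)^*))%:E).
  have [rf jf] := L2fun_sqint f'; have [rg jg] := L2fun_sqint g'.
  apply: eq_integrable (integrableB measurable_I (real_sqint_mul jf rg)
    (real_sqint_mul rf jg)) => // x _ /=.
  by case: (f' x) (g' x) => a b [p q] /=; rewrite mulrN addrC.
have fg : ae_eq mu I (fun x => repr (\pi_L2 f) x * (repr (\pi_L2 g) x)^*)
    (fun x => f x * (g x)^*).
  apply: filterS2 (repr_L2 f) (repr_L2 g) => x fx gx Ix.
  by rewrite fx// gx.
congr Complex; congr fine; apply: ae_eq_integral => //.
- by have /integrableP[] := iRe (repr (\pi_L2 f)) (repr (\pi_L2 g)).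
- by have /integrableP[] := iRe f g.
- by apply: filterS fg => x fgx Ix; rewrite fgx.
- by have /integrableP[] := iIm (repr (\pi_L2 f)) (repr (\pi_L2 g)).
- by have /integrableP[] := iIm f g.
- by apply: filterS fg => x fgx Ix; rewrite fgx.
Qed.

Definition is_adjoint (A B : L2 -> L2) : Prop :=
  forall u v, L2_inner (A u) v = L2_inner u (B v).

Lemma volterra_is_adjoint : is_adjoint volterra volterra_adj.
Proof.
move=> u v; rewrite -[u]reprK -[v]reprK volterra_pi volterra_adj_pi !L2_inner_pi.
move: (repr u) (repr v) => f g.
have [rf jf] := L2fun_sqint f; have [rg jg] := L2fun_sqint g.
have iRf := integrable_Re f; have iJf := integrable_Im f.
have iRg := integrable_Re g; have iJg := integrable_Im g.
have V (p : R -> R) : mu.-integrable I (EFin \o p) ->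
  real_sqint (real_volterra p) := @real_sqint_volterra R p.
have W (p : R -> R) : mu.-integrable I (EFin \o p) ->
  real_sqint (real_volterra_adj p) := @real_sqint_volterra_adj R p.
have Vr := V _ iRf; have Vj := V _ iJf; have Wr := W _ iRg; have Wj := W _ iJg.
congr Complex.
  transitivity (\int[mu]_(x in I) (real_volterra (Re \o f) x * Re (g x) +
      real_volterra (Im \o f) x * Im (g x))).
    by apply: eq_Rintegral => x _ /=; case: (g x) => p q /=; rewrite mulrN opprK.
  transitivity (\int[mu]_(x in I) (Re (f x) * real_volterra_adj (Re \o g) x +
      Im (f x) * real_volterra_adj (Im \o g) x)); last first.
    by apply: eq_Rintegral => x _ /=; case: (f x) => p q /=; rewrite mulrN opprK.
  rewrite !RintegralD//; [|exact: real_sqint_mul..].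
  by congr (_ + _); exact: real_volterra_adjoint.
transitivity (\int[mu]_(x in I) (real_volterra (Im \o f) x * Re (g x) -
    real_volterra (Re \o f) x * Im (g x))).
  by apply: eq_Rintegral => x _ /=; case: (g x) => p q /=; rewrite mulrN addrC.
transitivity (\int[mu]_(x in I) (Im (f x) * real_volterra_adj (Re \o g) x -
    Re (f x) * real_volterra_adj (Im \o g) x)); last first.
  by apply: eq_Rintegral => x _ /=; case: (f x) => p q /=; rewrite mulrN addrC.
rewrite !RintegralB//; [|exact: real_sqint_mul..].
by congr (_ - _); exact: real_volterra_adjoint.
Qed.

End complex_L2.

Definition imaginary_part (R : realType) (E : lmodType R[i])
    (A Aadj : E -> E) (u : E) : E :=
  (2 * 'i)^-1 *: (A u - Aadj u).

Definition is_eigenvalue (K : fieldType) (E : lmodType K) (A : E -> E)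
    (a : K) : Prop :=
  exists2 u : E, u != 0 & A u = a *: u.

Definition volterra_im (R : realType) : L2 R -> L2 R :=
  imaginary_part (@volterra R) (@volterra_adj R).

(* Main.v *)
(* Write F = V f.  Since V^* f = F(1) - F, the equation (Im V) f = a f reads
   F - F(1)/2 = i a f.  For a = 0 it makes F constant, so f = 0.  For a != 0 the
   function H = F - F(1)/2 solves H' = H / (i a) on ]0, 1[ with H(1) = - H(0),
   so H = H(0) exp(x / (i a)) with H(0) != 0 and exp(1 / (i a)) = -1, which says
   that 1 / a is an odd multiple of pi.  Conversely f = exp(- i x / a) is then
   an eigenfunction. *)
Require Import Defs.
From mathcomp Require Import all_boot all_order all_algebra.
From mathcomp Require Import all_classical all_reals all_analysis.
From mathcomp Require Import complex.
From mathcomp Require Import zify ring.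
Import Order.TTheory GRing.Theory Num.Theory.
Import numFieldNormedType.Exports.

Set Implicit Arguments.
Unset Strict Implicit.
Unset Printing Implicit Defensive.

Local Open Scope ring_scope.
Local Open Scope complex_scope.
Local Open Scope classical_set_scope.

(** * Zeros of sine, and the real solutions of $e^{a+ib}=-1$ *)

Section trig.
Context {R : realType}.

Lemma sin_int_pi (k : int) : sin (k%:~R * pi : R) = 0.
Proof.
have sn (n : nat) : sin (n%:R * pi : R) = 0.
  rewrite mulr_natl -[_ *+ n]add0r (alternatingn (@sinDpi R)).
  by rewrite sin0 mulr0.
case: k => n; first exact: sn.
by rewrite NegzE mulrNz mulNr sinN sn oppr0.
Qed.

Lemma cos_int_pi (k : int) : cos (k%:~R * pi : R) = (-1) ^+ `|k|%N.
Proof.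
have cn (n : nat) : cos (n%:R * pi : R) = (-1) ^+ n.
  rewrite mulr_natl -[_ *+ n]add0r (alternatingn (@cosDpi R)).
  by rewrite cos0 mulr1.
case: k => n; first exact: cn.
by rewrite NegzE mulrNz mulNr cosN abszN cn.
Qed.

(** Subtracting [Num.floor (x / pi)] copies of $\pi$ brings $x$ into $[0,\pi[$, where sine vanishes
    only at 0. *)
Lemma sin_eq0 (x : R) : sin x = 0 -> exists k : int, x = k%:~R * pi.
Proof.
move=> sx; have pi0 := pi_gt0 R.
exists (Num.floor (x / pi)).
set k := Num.floor _; set r := x - k%:~R * pi.
have sr : sin r = 0 by rewrite sinB sx sin_int_pi mul0r mulr0 subrr.
have r0 : 0 <= r by rewrite subr_ge0 -ler_pdivlMr// floor_le_tmp.
have r1 : r < pi.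
  rewrite ltrBlDl -[X in _ + X]mul1r -mulrDl -ltr_pdivrMr//.
  by have := floorD1_gt (x / pi); rewrite intrD.
move: r0; rewrite le_eqVlt => /predU1P[/esym/eqP|r0].
  by rewrite subr_eq0 => /eqP.
by have := sin_gt0_pi (introT andP (conj r0 r1)); rewrite sr ltxx.
Qed.

(** The hypotheses are the two parts of $e^{a+ib}=-1$. The second puts $b$ at some $m\pi$; the first
    then reads $e^a(-1)^m=-1$, so $m$ is odd by positivity and $e^a=1$. *)
Lemma expR_cis_eqN1 (a b : R) :
  expR a * cos b = -1 -> expR a * sin b = 0 ->
  a = 0 /\ exists k : int, b = (2 * k + 1)%:~R * pi.
Proof.
move=> ec /eqP; rewrite mulf_eq0 gt_eqF ?expR_gt0//= => /eqP/sin_eq0[m bm].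
move: ec; rewrite bm cos_int_pi -signr_odd.
have [om|] := boolP (odd `|m|%N); last first.
  by move=> _; rewrite mulr1 => e; have := expR_gt0 a; rewrite e ltr0N1.
rewrite expr1 mulrN1 => /oppr_inj; rewrite -expR0 => /expR_inj a0.
split => //; suff [k ->] : exists k : int, m = 2 * k + 1 by exists k.
case: m om {bm} => n /= on.
  exists n./2%:Z.
  by rewrite -[in LHS](odd_double_half n) on -muln2 PoszD PoszM mulrC addrC.
(* Here $m=-(n+1)$ with $n=2j$ even, and $-(2j+1)=2(-(j+1))+1$. *)
exists (- (n./2%:Z + 1)).
move: on; rewrite NegzE => /negPf on.
rewrite -[in LHS](odd_double_half n) on -muln2 add0n -addn1 PoszD PoszM.
by ring.
Qed.

End trig.

(** * Differentiation of the Volterra integral, and a planar linear differential system *)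

Section real.
Context {R : realType}.
Notation mu := (@lebesgue_measure R).
Notation T := (measurableTypeR R).
Notation I := (`[0%R, 1%R] : set T).
Implicit Types g k : R -> R.

Lemma near_oo_I (x : R) : 0 < x < 1 -> \forall y \near x, I y.
Proof.
move=> /andP[x0 x1]; near=> y; rewrite /= in_itv/=; apply/andP; split.
- by apply: ltW; near: y; exact: lt_nbhsr.
- by apply: ltW; near: y; exact: lt_nbhsl.
Unshelve. all: by end_near. Qed.

Lemma I_ae_oo : {ae mu, forall x : T, I x -> 0 < x < 1}.
Proof.
have ne (a : R) : {ae mu, forall x : T, x != a}.
  exists [set a]; split => //; first exact: lebesgue_measure_set1.
  by move=> x /= /negP; rewrite negbK => /eqP.
apply: filterS2 (ne 0) (ne 1) => x x0 x1 /=.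
by rewrite in_itv/= !le_eqVlt eq_sym (negPf x0) (negPf x1).
Qed.

(** This is Lebesgue differentiation, applied to the extension [gI] of [g] by zero because that
    theorem lives on the whole line. The two primitives agree on [I], hence near every interior
    point. *)
Lemma ae_is_derive_real_volterra g : mu.-integrable I (EFin \o g) ->
  {ae mu, forall x : T, I x -> is_derive x 1 (real_volterra g) (g x)}.
Proof.
move=> ig; pose gI := g \_ I.
have igI : mu.-integrable I (EFin \o gI).
  by apply: eq_integrable ig => // x xI; rewrite /= /gI patchE xI.
have VE x : I x -> real_volterra gI x = real_volterra g x.
  rewrite /= in_itv/= => /andP[x0 x1]; apply: eq_Rintegral => t.
  rewrite inE/= in_itv/= => /andP[t0 tx].
  by rewrite /gI patchE ifT// inE/= in_itv/= t0 (le_trans tx).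
have locg : locally_integrable setT gI by exact: integrable_locally.
apply: filterS2 I_ae_oo (lebesgue_differentiation locg) => x oox lx Ix.
have {}oox := oox Ix; have /andP[x0 x1] := oox.
have [dV V'] := FTC1_lebesgue_pt x1 igI x0 lx.
apply: (@near_eq_is_derive _ _ _ (real_volterra gI)).
  by apply: filterS (near_oo_I oox) => y; exact: VE.
apply: DeriveDef; first exact: dV.
by rewrite -derive1E V' /gI patchE ifT// inE.
Qed.

Lemma real_volterra_cst_ae0 g c : mu.-integrable I (EFin \o g) ->
  (forall x, 0 < x < 1 -> real_volterra g x = c) -> ae_eq mu I g (cst 0).
Proof.
move=> ig Vc.
apply: filterS2 I_ae_oo (ae_is_derive_real_volterra ig) => x oox dx Ix.
have {}oox := oox Ix; have [_ <-] := dx Ix.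
rewrite (@near_eq_derive _ _ _ _ (cst c)) ?derive_cst//.
have /andP[x0 x1] := oox; near=> y; apply: Vc; apply/andP; split.
- by near: y; exact: lt_nbhsr.
- by near: y; exact: lt_nbhsl.
Unshelve. all: by end_near. Qed.

(** Replacing [g] by its continuous representative [k] leaves the primitive unchanged on [I], so the
    derivative exists at every interior point, not just almost everywhere. *)
Lemma is_derive_real_volterra g k (x : R) : mu.-integrable I (EFin \o g) ->
  {within I, continuous k} -> ae_eq mu I g k -> 0 < x < 1 ->
  is_derive x 1 (real_volterra g) (k x).
Proof.
move=> ig ck gk oox; have /andP[x0 x1] := oox.
have ik := real_sqint_integrable (continuous_real_sqint ck).
apply: (@near_eq_is_derive _ _ _ (real_volterra k)).
  apply: filterS (near_oo_I oox) => y Iy.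
  by apply/esym/real_volterra_ae_eq.
have ckx : {for x, continuous k}.
  apply: (within_continuous_continuous ltr01 ck).
  by rewrite in_itv/= x0.
have [dV V'] := continuous_FTC1_closed x1 ik x0 ckx.
by apply: DeriveDef; [exact: dV|rewrite -derive1E V'].
Qed.

(** As [k] is a continuous representative of 0, it is the derivative of the primitive of 0. *)
Lemma continuous_ae0_eq0 k (x : R) : {within I, continuous k} ->
  ae_eq mu I k (cst 0) -> 0 < x < 1 -> k x = 0.
Proof.
move=> ck k0 oox.
have [_ <-] : is_derive x 1 (real_volterra (cst 0)) (k x).
  apply: is_derive_real_volterra ck _ oox; first exact: (integrable_cst_I 0).
  by apply: filterS k0 => y ky /ky.
rewrite (_ : real_volterra _ = cst 0) ?derive_cst//.
by apply/funext => y; rewrite /real_volterra Rintegral_cst// mul0r.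
Qed.

Lemma real_volterra0 g : real_volterra g 0 = 0.
Proof. by rewrite /real_volterra set_itv1 Rintegral_set1. Qed.

Lemma within_is_derive0_cst (f : R -> R) : {within I, continuous f} ->
  (forall x : R, 0 < x < 1 -> is_derive x 1 f 0) -> forall x, I x -> f x = f 0.
Proof.
move=> cf df x; rewrite /= in_itv/= => /andP[x0 x1].
have sub : `[0, x] `<=` (I : set R).
  by move=> y /=; rewrite !in_itv/= => /andP[-> /le_trans->].
have [|c _] := @MVT_segment _ f (cst 0) _ _ x0 _ (continuous_subspaceW sub cf).
  move=> y; rewrite in_itv/= => /andP[y0 yx]; apply: df.
  by rewrite y0 (lt_le_trans yx).
by rewrite mul0r => /eqP; rewrite subr_eq0 => /eqP.
Qed.

#[export] Instance is_derive_mull (b x : R) : is_derive x 1 ( *%R b) b.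
Proof.
have := @is_deriveZ R R R id b x 1 1 (is_derive_id x 1).
by rewrite /GRing.scale/= mulr1.
Qed.

(** With $z=p+iq$ and $m=a+ib$ the system is $z'=mz$, so $e^{-mx}z$ is constant. *)
Lemma linear_ode_sol (p q : R -> R) (a b : R) :
  {within I, continuous p} -> {within I, continuous q} ->
  (forall x : R, 0 < x < 1 -> is_derive x 1 p (a * p x - b * q x)) ->
  (forall x : R, 0 < x < 1 -> is_derive x 1 q (b * p x + a * q x)) ->
  forall x, I x ->
    p x = expR (a * x) * (cos (b * x) * p 0 - sin (b * x) * q 0) /\
    q x = expR (a * x) * (sin (b * x) * p 0 + cos (b * x) * q 0).
Proof.
move=> cp cq dp dq.
pose E : R -> R := expR \o ( *%R (- a)).
pose C : R -> R := cos \o ( *%R b).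
pose S : R -> R := sin \o ( *%R b).
have dE (x : R) : is_derive x 1 E (E x * - a) by exact: is_derive1_comp.
have dC (x : R) : is_derive x 1 C (- S x * b) by exact: is_derive1_comp.
have dS (x : R) : is_derive x 1 S (C x * b) by exact: is_derive1_comp.
have cts (f df : R -> R) : (forall x : R, is_derive x 1 f (df x)) ->
    {within I, continuous f}.
  move=> dff; apply: derivable_within_continuous => x _.
  by have [] := dff x.
(* [P] and [Q] are the real and imaginary parts of $e^{-mx}z(x)$. *)
pose P := E * (p * C + q * S); pose Q := E * (q * C - p * S).
have cE := cts _ _ dE; have cC := cts _ _ dC; have cS := cts _ _ dS.
have cP : {within I, continuous P}.
  by move=> x; apply: cvgM; [exact: cE|apply: cvgD; apply: cvgM;
    [exact: cp|exact: cC|exact: cq|exact: cS]].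
have cQ : {within I, continuous Q}.
  by move=> x; apply: cvgM; [exact: cE|apply: cvgB; apply: cvgM;
    [exact: cq|exact: cC|exact: cp|exact: cS]].
have dP (x : R) : 0 < x < 1 -> is_derive x 1 P 0.
  move=> oox; have dpx := dp x oox; have dqx := dq x oox.
  apply: is_derive_eq; rewrite /GRing.scale/=.
  rewrite -[(p * C + q * S) x]/(p x * C x + q x * S x); ring.
have dQ (x : R) : 0 < x < 1 -> is_derive x 1 Q 0.
  move=> oox; have dpx := dp x oox; have dqx := dq x oox.
  apply: is_derive_eq; rewrite /GRing.scale/=.
  rewrite -[(q * C - p * S) x]/(q x * C x - p x * S x); ring.
move=> x Ix.
have := within_is_derive0_cst cP dP Ix; have := within_is_derive0_cst cQ dQ Ix.
rewrite -[Q x]/(expR (- a * x) * (q x * cos (b * x) - p x * sin (b * x))).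
rewrite -[Q 0]/(expR (- a * 0) * (q 0 * cos (b * 0) - p 0 * sin (b * 0))).
rewrite -[P x]/(expR (- a * x) * (p x * cos (b * x) + q x * sin (b * x))).
rewrite -[P 0]/(expR (- a * 0) * (p 0 * cos (b * 0) + q 0 * sin (b * 0))).
rewrite !mulr0 expR0 cos0 sin0 !mulr0 !mulr1 subr0 addr0 !mul1r => <- <-.
have e1 : expR (a * x) * expR (- a * x) = 1.
  by rewrite -expRD mulNr subrr expR0.
have := cos2Dsin2 (b * x); set c := cos _; set s := sin _ => cs.
move: e1; set e := expR _; set e' := expR _ => e1.
(* [p 0] and [q 0] have been replaced by their expressions at [x]; it remains to undo a scaling and
   a rotation, with [e * e' = 1] and [c ^+ 2 + s ^+ 2 = 1]. *)
split.
  transitivity (e * e' * (c ^+ 2 + s ^+ 2) * p x); last by ring.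
  by rewrite e1 cs !mul1r.
transitivity (e * e' * (c ^+ 2 + s ^+ 2) * q x); last by ring.
by rewrite e1 cs !mul1r.
Qed.

Lemma real_volterra_derive (F f : R -> R) (x : R) :
  (forall y : R, is_derive y 1 F (f y)) -> continuous f -> 0 <= x ->
  real_volterra f x = F x - F 0.
Proof.
move=> dF cf; rewrite le_eqVlt => /predU1P[<-|x0].
  by rewrite real_volterra0 subrr.
have cF : continuous F.
  move=> y; apply/differentiable_continuous/derivable1_diffP.
  by have [] := dF y.
rewrite /real_volterra /Rintegral (continuous_FTC2 x0 (F := F))//.
- exact: continuous_subspaceT.
- split; first by move=> y _; have [] := dF y.
    by apply: cvg_at_right_filter; exact: cF.
  by apply: cvg_at_left_filter; exact: cF.
- by move=> y _; rewrite derive1E; have [] := dF y.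
Qed.

Lemma continuous_cos_scal (b : R) : continuous (fun x : R => cos (b * x)).
Proof.
move=> x; apply: (@continuous_comp _ _ _ ( *%R b) cos).
  exact: mulrl_continuous.
exact: continuous_cos.
Qed.

Lemma continuous_sin_scal (b : R) : continuous (fun x : R => sin (b * x)).
Proof.
move=> x; apply: (@continuous_comp _ _ _ ( *%R b) sin).
  exact: mulrl_continuous.
exact: continuous_sin.
Qed.

End real.

(** * The eigenvalue equation, reduced to a differential system for two real functions *)

Section eigen.
Variable R : realType.
Notation mu := (@lebesgue_measure R).
Notation T := (measurableTypeR R).
Notation I := (`[0%R, 1%R] : set T).
Notation Re := (@complex.Re R).
Notation Im := (@complex.Im R).
Local Open Scope quotient_scope.
Notation piL2 := (\pi_(L2 R)).

Lemma volterra_im_eigenE (f : L2fun R) (a : R[i]) :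
  volterra_im (piL2 f) = a *: piL2 f <->
  ae_eq mu I (fun x => volterra_fun f x - volterra_fun f 1 / 2)
    (fun x => 'i * a * f x).
Proof.
have i0 : ('i : R[i]) != 0 by exact: neq0Ci.
rewrite /volterra_im /imaginary_part volterra_pi volterra_adj_pi.
set g := MkL2fun _; set h := MkL2fun _.
have -> : piL2 g - piL2 h = piL2 (g - h) by rewrite piE.
rewrite -!pi_L2Z L2_eqP.
have E x : I x -> ((2 * 'i)^-1 *: (g - h)) x =
    (volterra_fun f x - volterra_fun f 1 / 2) / 'i.
  move=> Ix.
  rewrite -[LHS]/((2 * 'i)^-1 * (volterra_fun f x - volterra_adj_fun f x)).
  by rewrite volterra_adj_funE//; field; rewrite i0.
split; apply: filterS => x fx Ix.
  have := fx Ix; rewrite E// => /(canRL (divfK i0)) ->.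
  by rewrite -mulrA mulrC.
rewrite E// fx// -[RHS]/(a * f x); field; exact: i0.
Qed.

(** For [g] the real or imaginary part of $f$, this is the same part of the function $H$ of the
    overview; subtracting half the final value makes its values at 0 and 1 opposite. *)
Definition centered_volterra (g : R -> R) (x : R) : R :=
  real_volterra g x - real_volterra g 1 / 2.

Lemma continuous_centered_volterra g : mu.-integrable I (EFin \o g) ->
  {within I, continuous (centered_volterra g)}.
Proof.
move=> ig x; apply: cvgB; last exact: cvg_cst.
exact: (parameterized_integral_continuous ler01 ig).
Qed.

Lemma is_derive_centered_volterra g k (x : R) : mu.-integrable I (EFin \o g) ->
  {within I, continuous k} -> ae_eq mu I g k -> 0 < x < 1 ->
  is_derive x 1 (centered_volterra g) (k x).
Proof.
move=> ig ck gk oox; have dV := is_derive_real_volterra ig ck gk oox.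
rewrite -[k x]subr0.
exact: (is_deriveB dV (is_derive_cst (real_volterra g 1 / 2) x 1)).
Qed.

Lemma centered_volterra0 g : centered_volterra g 0 = - (real_volterra g 1 / 2).
Proof. by rewrite /centered_volterra real_volterra0 sub0r. Qed.

Lemma centered_volterra1 g : centered_volterra g 1 = real_volterra g 1 / 2.
Proof. by rewrite /centered_volterra; field. Qed.

(** This settles $a=0$: by continuity the centered primitive vanishes on all of $]0,1[$, so the
    primitive is constant there and its derivative, [g] almost everywhere, is 0. *)
Lemma centered_volterra_ae0 g : mu.-integrable I (EFin \o g) ->
  ae_eq mu I (centered_volterra g) (cst 0) -> ae_eq mu I g (cst 0).
Proof.
move=> ig c0.
apply: (@real_volterra_cst_ae0 _ _ (real_volterra g 1 / 2)) => // x oox.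
have := continuous_ae0_eq0 (continuous_centered_volterra ig) c0 oox.
by move=> /eqP; rewrite subr_eq0 => /eqP.
Qed.

Lemma centered_volterra_funE (f : R -> R[i]) x :
  volterra_fun f x - volterra_fun f 1 / 2 =
  centered_volterra (Re \o f) x +i* centered_volterra (Im \o f) x.
Proof.
have -> : (2 : R[i])^-1 = (2^-1)%:C by rewrite fmorphV rmorph_nat.
apply/eqP; rewrite eq_complex/= !mulr0 subr0 add0r.
by rewrite !eqxx.
Qed.

(** For $a\neq 0$ the equation itself gives regularity: $f$ is almost everywhere a multiple of the
    continuous $H=u+iv$, so $u$ and $v$ are differentiable on $]0,1[$ and solve a linear system. *)
Lemma volterra_im_eigenvalue (f : L2fun R) (a : R[i]) :
  ~ ae_eq mu I f (cst 0) ->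
  ae_eq mu I (fun x => volterra_fun f x - volterra_fun f 1 / 2)
    (fun x => 'i * a * f x) ->
  exists n : int, a = (1 / ((2 * n + 1)%:~R * pi) : R)%:C.
Proof.
move=> f0 eigf.
have iRe := integrable_Re f; have iIm := integrable_Im f.
set u := centered_volterra (Re \o f); set v := centered_volterra (Im \o f).
have cu : {within I, continuous u} by exact: continuous_centered_volterra.
have cv : {within I, continuous v} by exact: continuous_centered_volterra.
have {}eigf : ae_eq mu I (fun x => u x +i* v x) (fun x => 'i * a * f x).
  by apply: filterS eigf => x fx Ix; rewrite -fx// centered_volterra_funE.
have aeC (p q : R -> R) : ae_eq mu I p (cst 0) -> ae_eq mu I q (cst 0) ->
    ae_eq mu I (fun x => p x +i* q x) (cst 0).
  by apply: filterS2 => x px qx Ix; rewrite px// qx.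
have [a0|a0] := eqVneq a 0.
  exfalso; apply: f0; have eigf0 : ae_eq mu I (fun x => u x +i* v x) (cst 0).
    by apply: filterS eigf => x fx Ix; rewrite fx// a0 mulr0 mul0r.
  have R0 := centered_volterra_ae0 iRe (ae_eq_Re eigf0).
  have I0 := centered_volterra_ae0 iIm (ae_eq_Im eigf0).
  apply: filterS (aeC _ _ R0 I0) => x fx Ix; rewrite -[RHS]fx//=.
  by case: (L2fun_val f x).
have i0 : ('i : R[i]) != 0 by exact: neq0Ci.
have ia0 : 'i * a != 0 by rewrite mulf_neq0.
pose m := ('i * a)^-1.
have fE : ae_eq mu I f (fun x => m * (u x +i* v x)).
  by apply: filterS eigf => x fx Ix; rewrite fx// mulrA mulVf// mul1r.
pose al := Re m; pose be := Im m.
(* The two parts of $mH$, which are continuous representatives of the two parts of $f$. *)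
pose k1 x := al * u x - be * v x; pose k2 x := be * u x + al * v x.
have ck1 : {within I, continuous k1}.
  by move=> x; apply: cvgB; apply: cvgM;
    [exact: cvg_cst|exact: cu|exact: cvg_cst|exact: cv].
have ck2 : {within I, continuous k2}.
  by move=> x; apply: cvgD; apply: cvgM;
    [exact: cvg_cst|exact: cu|exact: cvg_cst|exact: cv].
have f1 : ae_eq mu I (Re \o f) k1.
  by apply: filterS fE => x fx Ix; rewrite /= fx// /k1 /al /be; case: (m).
have f2 : ae_eq mu I (Im \o f) k2.
  by apply: filterS fE => x fx Ix; rewrite /= fx// /k2 /al /be addrC; case: (m).
have sol := linear_ode_sol cu cv
  (fun x => is_derive_centered_volterra iRe ck1 f1)
  (fun x => is_derive_centered_volterra iIm ck2 f2).
have u1 : u 1 = - u 0 by rewrite /u centered_volterra0 centered_volterra1 opprK.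
have v1 : v 1 = - v 0 by rewrite /v centered_volterra0 centered_volterra1 opprK.
(* If $H(0)=0$, the solution formula gives $H=0$ on [I], hence $f=0$ almost everywhere. *)
have uv0 : u 0 ^+ 2 + v 0 ^+ 2 != 0.
  apply/eqP => uv0; apply: f0.
  have [u0 v0] : u 0 = 0 /\ v 0 = 0.
    have /eqP := uv0; rewrite paddr_eq0 ?sqr_ge0// !sqrf_eq0.
    by move=> /andP[/eqP-> /eqP->].
  apply: filterS fE => x fx Ix; rewrite fx//.
  by have [-> ->] := sol _ Ix; rewrite u0 v0 !mulr0 addr0 subr0 mulr0;
    exact: mulr0.
have I1 : I 1 by rewrite /= in_itv/= ler01 lexx.
have := sol _ I1; rewrite u1 v1 !mulr1.
set e := expR al; set c := cos be; set s := sin be => -[eu ev].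
(* The boundary condition is $e^m H(0)=-H(0)$. Multiplying by the conjugate of $H(0)$ and taking
   real parts here, imaginary parts for [es], leaves the factor $|H(0)|^2\neq 0$ to cancel. *)
have ec : e * c = -1.
  apply: (mulIf uv0); transitivity
    (e * (c * u 0 - s * v 0) * u 0 + e * (s * u 0 + c * v 0) * v 0);
    first by ring.
  by rewrite -eu -ev; ring.
have es : e * s = 0.
  apply: (mulIf uv0); transitivity
    (e * (s * u 0 + c * v 0) * u 0 - e * (c * u 0 - s * v 0) * v 0);
    first by ring.
  by rewrite -eu -ev; ring.
have [al0 [k bek]] := expR_cis_eqN1 ec es.
(* From $1/(ia)=m=i\beta$ with $\beta=(2k+1)\pi$ follows $1/a=-\beta$, and $-(2k+1)=2(-k-1)+1$. *)
exists (- k - 1).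
have mE : m = 'i * be%:C.
  by rewrite -complexiE /be; move: al0;
    rewrite /al; case: (m) => x y /= ->; simpc.
have -> : a = - be^-1%:C.
  have be0 : be%:C != 0.
    by apply: contra_neq ia0 => b0; rewrite -[LHS]invrK -/m mE b0 mulr0 invr0.
  have -> : a = m^-1 / 'i by rewrite /m invrK mulrC mulKf.
  rewrite mE fmorphV; have i2 : ('i : R[i]) ^+ 2 = -1 by exact: sqrCi.
  have -> : - (be%:C)^-1 = (be%:C)^-1 * ('i ^+ 2)^-1
    by rewrite i2 invrN1 mulrN1.
  by field; rewrite be0 i0.
rewrite -rmorphN bek; congr (_%:C).
have -> : (2 * (- k - 1) + 1 : int) = - (2 * k + 1) by ring.
by rewrite mulrNz mulNr invrN mulrN mul1r.
Qed.

(** * The eigenfunctions, built from $x\mapsto e^{ibx}$ *)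

Definition cis (b x : R) : R[i] := cos (b * x) +i* sin (b * x).

Lemma sqint_cis (b : R) : cis b \in @sqint_pred R.
Proof.
rewrite inE/=; apply/square_integrableP; split; apply: continuous_real_sqint.
- exact/continuous_subspaceT/continuous_cos_scal.
- exact/continuous_subspaceT/continuous_sin_scal.
Qed.

Definition cisL2 (b : R) : L2fun R := MkL2fun (sqint_cis b).

(** The value is $(e^{ibx}-1)/(ib)$; each part comes from an explicit antiderivative. *)
Lemma volterra_cis (b x : R) : b != 0 -> 0 <= x ->
  volterra_fun (cis b) x = (sin (b * x) / b) +i* ((1 - cos (b * x)) / b).
Proof.
move=> b0 x0; congr Complex.
  transitivity (sin (b * x) / b - sin (b * 0) / b); last first.
    by rewrite mulr0 sin0 mul0r subr0.
  pose F : R -> R := b^-1 \*: (sin \o ( *%R b)).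
  have dF (y : R) : is_derive y 1 F (cos (b * y)).
    rewrite (_ : cos _ = b^-1 *: (cos (b * y) * b)).
      by apply: is_deriveZ; exact: is_derive1_comp.
    by rewrite /GRing.scale/=; field.
  rewrite [LHS](real_volterra_derive dF (@continuous_cos_scal R b) x0).
  by rewrite /F/= /GRing.scale/= ![b^-1 * _]mulrC.
transitivity (- cos (b * x) / b - - cos (b * 0) / b); last first.
  by rewrite mulr0 cos0; field.
pose F : R -> R := - b^-1 \*: (cos \o ( *%R b)).
have dF (y : R) : is_derive y 1 F (sin (b * y)).
  rewrite (_ : sin _ = - b^-1 *: (- sin (b * y) * b)).
    by apply: is_deriveZ; exact: is_derive1_comp.
  by rewrite /GRing.scale/=; field.
rewrite [LHS](real_volterra_derive dF (@continuous_sin_scal R b) x0).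
by rewrite /F/= /GRing.scale/=; field.
Qed.

(** Otherwise continuity would make cosine and sine of $b/2$ both vanish, against
    $\cos^2+\sin^2=1$. *)
Lemma cis_not_ae0 (b : R) : ~ ae_eq mu I (cis b) (cst 0).
Proof.
move=> cis0.
have oo2 : 0 < (2^-1 : R) < 1 by rewrite invr_gt0 ltr0n invf_lt1// ltr1n.
have c0 := continuous_ae0_eq0 (continuous_subspaceT (@continuous_cos_scal R b))
  (ae_eq_Re cis0) oo2.
have s0 := continuous_ae0_eq0 (continuous_subspaceT (@continuous_sin_scal R b))
  (ae_eq_Im cis0) oo2.
have := cos2Dsin2 (b / 2); rewrite c0 s0 expr0n addr0 => /eqP.
by rewrite eq_sym oner_eq0.
Qed.

(** For $f=e^{-ibx}$ and $F=Vf$, $e^{-ib}=-1$ gives $F(1)/2=1/(ib)$, which is exactly the constant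
    term of $F$. What is left is $F-F(1)/2=(i/b)f$. *)
Lemma volterra_im_cis (n : int) :
  let b : R := (2 * n + 1)%:~R * pi in
  volterra_im (piL2 (cisL2 (- b))) = (1 / b)%:C *: piL2 (cisL2 (- b)).
Proof.
move=> b; have b0 : b != 0.
  by rewrite mulf_neq0 ?(gt_eqF (pi_gt0 R))// intr_eq0; lia.
have Nb0 : - b != 0 by rewrite oppr_eq0.
apply/volterra_im_eigenE; apply: aeW => x.
rewrite /= in_itv/= => /andP[x0 _].
have cb : cos b = -1.
  by rewrite cos_int_pi -signr_odd (_ : odd _ = true) ?expr1//; lia.
have sb : sin b = 0 by exact: sin_int_pi.
rewrite !volterra_cis// mulr1 cosN sinN cb sb oppr0 mul0r.
have -> : (2 : R[i])^-1 = (2^-1)%:C by rewrite fmorphV rmorph_nat.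
rewrite -complexiE /cis; apply/eqP; rewrite eq_complex/=.
by apply/andP; split; apply/eqP; field; exact: b0.
Qed.
End eigen.

Theorem theorem2p4 (R : realType) :
  [set a : R[i] | is_eigenvalue (@volterra_im R) a] =
  [set (1 / ((2 * n + 1)%:~R * pi) : R)%:C | n in [set: int]].
Proof.
pose piL2 (f : L2fun R) := (\pi_(L2 R) f)%qT.
(* A class is nonzero exactly when its representatives do not vanish almost everywhere, so both
   inclusions reduce to functions. *)
have pi0 (f : L2fun R) :
    piL2 f = 0 <-> ae_eq lebesgue_measure `[0, 1] f (cst 0).
  have -> : (0 : L2 R) = piL2 0 by rewrite /piL2 piE.
  exact: L2_eqP.
apply/seteqP; split => a /=.
  move=> [u u0 eigu]; rewrite -[u]reprK in u0 eigu.
  have u_nae0 : ~ ae_eq lebesgue_measure `[0, 1] (repr u) (cst 0).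
    by move=> /pi0 u_eq0; rewrite -/(piL2 _) u_eq0 eqxx in u0.
  have [n ->] := volterra_im_eigenvalue u_nae0
    ((volterra_im_eigenE _ _).1 eigu).
  by exists n.
move=> [n _ <-]; exists (piL2 (cisL2 (- ((2 * n + 1)%:~R * pi)))).
  by apply/eqP => /pi0; exact: cis_not_ae0.
exact: volterra_im_cis.
Qed.
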